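(* Let $(G,\ell)$ be an embedded graph $G$ with a linear ordering $\ell$ of its edges, and fix $i$ with $1\le i\le |E(G)|$. Then $$(\tau^2,i)(G,\ell)=(\delta^2,i)(G,\ell)=((\tau\delta)^3,i)(G,\ell)=(1,i)(G,\ell)=(G,\ell).$$ Therefore, for fixed $i$, there is an action of the symmetric group $S_3$, with the presentation $$S_3\cong\mathfrak{G}:=\langle\delta,\tau\mid\delta^2,\tau^2,(\tau\delta)^3\rangle,$$ on the set of embedded graphs with linearly ordered edges (having an $i$-th edge), in which $\delta$ and $\tau$ act by $(\delta,i)$ and $(\tau,i)$.
   Context: Embedded graphs. An embedded graph is a finite graph (loops and multiple edges allowed) cellularly embedded in a closed, possibly non-orientable, surface. Equivalently, it is a ribbon graph (a surface with boundary decomposed into vertex discs and edge discs meeting in disjoint line segments, each segment lying on exactly one vertex disc and one edge disc, each edge disc containing exactly two segments). Equivalently, it is an arrow presentation: a set of circles with disjoint labelled arrows on them, each label appearing on exactly two arrows, up to relabelling pairs and reversing both arrows of a given label. Circles correspond to vertex discs; for each label $e$ an edge disc is attached by orienting its boundary, choosing two disjoint boundary arcs directed accordingly, and identifying these with the two $e$-labelled arrows respecting directions. Embedded graphs are considered up to isomorphism; ordered ones up to order-preserving isomorphism. Operations. Let $e_i$ be the $i$-th edge of $(G,\ell)$, with $G$ given as an arrow presentation. The half-twist of the $i$-th edge is $(\tau,i)(G,\ell)=(H,\ell)$, where $H$ is obtained from $G$ by reversing the direction of exactly one of the two $e_i$-labelled arrows. The dual with respect to the $i$-th edge is $(\delta,i)(G,\ell)=(H,\ell)$,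 where $H$ is obtained as follows: if $A,B$ are the two $e_i$-labelled arrows, draw a segment with an $e_i$-labelled arrow directed from the head of $A$ to the tail of $B$, and a segment with an $e_i$-labelled arrow directed from the head of $B$ to the tail of $A$, and delete $A$ and $B$ with the arcs containing them; the segments become arcs of new circle(s). In both cases $H$ inherits the edge order. For words $\xi,\zeta$ in $\tau,\delta$: $(\xi\zeta,i)(G,\ell):=(\xi,i)((\zeta,i)(G,\ell))$, and $(1,i)(G,\ell):=(G,\ell)$. *)

(* Defs.v *)
From HB Require Import structures.
From mathcomp Require Import all_boot all_fingroup all_solvable.
From mathcomp Require Import generic_quotient.

Set Implicit Arguments.
Unset Strict Implicit.
Unset Printing Implicit Defensive.

Local Open Scope group_scope.
Local Open Scope quotient_scope.

(* The set of labels is 'I_n.  Label e is carried by the two arrows (e, false)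
   and (e, true); the arrow (e, a) has the tail (e, a, false) and the head
   (e, a, true).  *)
Definition arrow_end n : finType := ('I_n * bool * bool)%type.

Definition is_pairing n (c : {perm arrow_end n}) : bool :=
  (c * c == 1) && [forall x, c x != x].

(* Removing the arrows from the circles of an arrow presentation leaves arcs,
   each of which joins two ends of arrows, and the circles without any arrow.
   An arrow presentation is thus given by the fixed-point free involution arc,
   which sends an end of an arrow to the other end of the complementary arc
   starting there, together with the number bare of circles without arrows.
   The remaining circles are recovered by following alternately arrows and
   arcs; any fixed-point free involution arises in this way. *)
Record arrow_pres n := ArrowPres {
  arc : {perm arrow_end n};
  bare : nat;
  arcP : is_pairing arc }.

Section ArrowPresChoice.

Variable n : nat.

Definition arrow_pres_sig (g : arrow_pres n) :
  {p : ({perm arrow_end n} * nat)%type | is_pairing p.1} :=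
  exist (fun p : ({perm arrow_end n} * nat)%type => is_pairing p.1)
        (arc g, bare g) (arcP g).

Definition sig_arrow_pres
  (p : {p : ({perm arrow_end n} * nat)%type | is_pairing p.1}) : arrow_pres n :=
  ArrowPres (val p).2 (valP p).

Lemma arrow_pres_sigK : cancel arrow_pres_sig sig_arrow_pres.
Proof. by case=> c k P; congr ArrowPres; apply: bool_irrelevance. Qed.

HB.instance Definition _ :=
  Choice.copy (arrow_pres n) (can_type arrow_pres_sigK).

End ArrowPresChoice.

Lemma is_pairingJ n (c p : {perm arrow_end n}) :
  is_pairing c -> is_pairing (c ^ p).
Proof.
case/andP=> /eqP cc /forallP cP; apply/andP; split.
  by rewrite -conjMg cc conj1g.
apply/forallP=> x; rewrite -[x](permKV p) permJ.
by apply: contra (cP (p^-1 x)) => /eqP /perm_inj ->.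
Qed.

(* All arrows are replaced by new ones, the arcs being kept: the end x of a new
   arrow is located where the end p x of an old arrow was, so that the new arc
   permutation sends x to p^-1 (arc g (p x)). *)
Definition replace_arrows n (p : {perm arrow_end n}) (g : arrow_pres n) :
  arrow_pres n :=
  ArrowPres (bare g) (is_pairingJ p^-1 (arcP g)).

(* Only the arrow (e, false) is reversed; reversing (e, true) instead gives an
   isomorphic presentation. *)
Definition half_twist n (e : 'I_n) : arrow_pres n -> arrow_pres n :=
  replace_arrows (tperm (e, false, false) (e, false, true)).

(* With A and B the arrows (e, a) and (e, ~~ a), the new arrow (e, a) goes from
   the head of A to the tail of B. *)
Definition dual_place n (e : 'I_n) (x : arrow_end n) : arrow_end n :=
  let: (l, a, h) := x in
  if l == e then (if h then (l, ~~ a, false) else (l, a, true)) else x.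

Lemma dual_place_inj n (e : 'I_n) : injective (dual_place e).
Proof.
move=> [[l a] h] [[l' a'] h'] /=.
by case: eqP => [->|ne]; case: eqP => [->|ne']; case: h; case: h' => //;
  case=> *; subst=> //; congr (_, _, _); apply: negb_inj.
Qed.

Definition partial_dual n (e : 'I_n) : arrow_pres n -> arrow_pres n :=
  replace_arrows (perm (@dual_place_inj n e)).

(* An arrow presentation with a linear order l of its labels, in which l k is
   the k-th label; the positions k are counted from 0. *)
Definition ordered_pres n := (arrow_pres n * {perm 'I_n})%type.

(* The change of names of the ends which relabels e as f e, exchanges the two
   arrows labelled e if s e, and reverses both of them if r e. *)
Definition rename n (f : {perm 'I_n}) (s r : {ffun 'I_n -> bool})
    (x : arrow_end n) : arrow_end n :=
  let: (e, a, h) := x in (f e, a (+) s e, h (+) r e).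

Definition renaming n (G H : ordered_pres n)
    (f : {perm 'I_n}) (s r : {ffun 'I_n -> bool}) : bool :=
  [forall x, rename f s r (arc G.1 x) == arc H.1 (rename f s r x)]
  && [forall k, f (G.2 k) == H.2 k].

Definition pres_iso n (G H : ordered_pres n) : bool :=
  (bare G.1 == bare H.1)
  && [exists f, exists s, exists r, renaming G H f s r].

Section PresIso.

Variable n : nat.
Implicit Types G H K : ordered_pres n.

Lemma pres_isoP G H :
  reflect (bare G.1 = bare H.1 /\ exists f s r, renaming G H f s r)
          (pres_iso G H).
Proof.
apply: (iffP andP) => [[/eqP bGH /existsP[f /existsP[s /existsP[r fsr]]]]|].
  by split=> //; exists f, s, r.
case=> -> [f [s [r fsr]]]; split=> //.
by apply/existsP; exists f; apply/existsP; exists s; apply/existsP; exists r.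
Qed.

Lemma pres_iso_refl : reflexive (@pres_iso n).
Proof.
move=> G; apply/pres_isoP; split=> //.
exists 1, [ffun=> false], [ffun=> false].
have id x : rename 1 [ffun=> false] [ffun=> false] x = x :> arrow_end n.
  by case: x => [[e a] h] /=; rewrite !ffunE perm1 !addbF.
by apply/andP; split; apply/forallP=> x; rewrite ?id ?perm1.
Qed.

Lemma pres_iso_symW G H : pres_iso G H -> pres_iso H G.
Proof.
case/pres_isoP=> b [f [s [r /andP[/forallP fA /forallP fL]]]].
apply/pres_isoP; split=> //; exists f^-1.
pose s' := [ffun e => s (f^-1 e)]; pose r' := [ffun e => r (f^-1 e)].
exists s', r'.
have K1 x : rename f^-1 s' r' (rename f s r x) = x.
  by case: x => [[e a] h] /=; rewrite !ffunE permK !addbK.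
have K2 x : rename f s r (rename f^-1 s' r' x) = x.
  by case: x => [[e a] h] /=; rewrite !ffunE permKV !addbK.
apply/andP; split; apply/forallP=> x.
  by rewrite -{1}[x]K2 -(eqP (fA _)) K1.
by rewrite -(eqP (fL x)) permK.
Qed.

Lemma pres_iso_sym : symmetric (@pres_iso n).
Proof. by move=> G H; apply/idP/idP; apply: pres_iso_symW. Qed.

Lemma pres_iso_trans : transitive (@pres_iso n).
Proof.
move=> H G K /pres_isoP[b1 [f1 [s1 [r1 /andP[/forallP A1 /forallP L1]]]]].
case/pres_isoP=> b2 [f2 [s2 [r2 /andP[/forallP A2 /forallP L2]]]].
apply/pres_isoP; split; first by rewrite b1.
pose s := [ffun e => s1 e (+) s2 (f1 e)]; pose r := [ffun e => r1 e (+) r2 (f1 e)].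
exists (f1 * f2), s, r; pose m := rename (f1 * f2) s r.
have mE x : m x = rename f2 s2 r2 (rename f1 s1 r1 x).
  by case: x => [[e a] h] /=; rewrite !ffunE permM !addbA.
apply/andP; split; apply/forallP=> x.
  by rewrite -/m !mE (eqP (A1 x)) (eqP (A2 _)).
by rewrite permM (eqP (L1 x)) (eqP (L2 x)).
Qed.

Canonical pres_iso_equiv :=
  EquivRel (@pres_iso n) pres_iso_refl pres_iso_sym pres_iso_trans.

End PresIso.

(* The embedded graphs with n linearly ordered edges *)
Definition oegraph n := {eq_quot (@pres_iso n)}.

Variant generator := Delta | Tau.

Definition gen_pres n (a : generator) (e : 'I_n) : arrow_pres n -> arrow_pres n :=
  match a with Delta => partial_dual e | Tau => half_twist e end.

Definition gen_ordered n (a : generator) (i : 'I_n) (G : ordered_pres n) :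
  ordered_pres n :=
  (gen_pres a (G.2 i) G.1, G.2).

Definition gen_op n (a : generator) (i : 'I_n) : oegraph n -> oegraph n :=
  lift_op1 (oegraph n) (gen_ordered a i).

Lemma replace_arrows_iso n (g h : arrow_pres n) (l l' : {perm 'I_n})
    (p q : {perm arrow_end n}) f s r s' r' :
    bare g = bare h -> renaming (g, l) (h, l') f s r ->
    (forall x, q (rename f s' r' x) = rename f s r (p x)) ->
  pres_iso (replace_arrows p g, l) (replace_arrows q h, l').
Proof.
move=> b /andP[/forallP fA fL] pq; apply/pres_isoP; split=> //.
exists f, s', r'; apply/andP; split=> //.
apply/forallP=> x; apply/eqP; apply: (@perm_inj _ q).
rewrite pq /= !conjgE !permM !invgK permKV permKV pq.
exact: (eqP (fA _)).
Qed.

Lemma gen_ordered_iso n (a : generator) (i : 'I_n) (G H : ordered_pres n) :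
  pres_iso G H -> pres_iso (gen_ordered a i G) (gen_ordered a i H).
Proof.
case: G H => [g l] [h l'] /pres_isoP[b [f [s [r fsr]]]].
have /= le : f (l i) = l' i by case/andP: (fsr) => _ /forallP /(_ i) /eqP.
rewrite /gen_ordered /= -le; set e := l i.
case: a => /=.
- pose s' := [ffun x => s x (+) ((x == e) && r x)].
  apply: (replace_arrows_iso (s' := s') (r' := r) b fsr).
  move=> [[x c] d]; rewrite !permE /= (inj_eq perm_inj) /s' !ffunE.
  case: eqP => [_|_] /=; last by rewrite addbF.
  by case: d; case: c => /=; case: (s x); case: (r x).
- pose r' := [ffun x => r x (+) ((x == e) && s x)].
  apply: (replace_arrows_iso (s' := s) (r' := r') b fsr).
  move=> [[x c] d]; rewrite !permE /= !xpair_eqE (inj_eq perm_inj) /r' !ffunE.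
  case: (x =P e) => [->|_] /=; last by rewrite addbF.
  by case: d; case: c => /=; case: (s e); case: (r e).
Qed.

Lemma pi_gen_op n (a : generator) (i : 'I_n) :
  {morph \pi_(oegraph n) : G / gen_ordered a i G >-> gen_op a i G}.
Proof.
move=> G; unlock gen_op; apply/eqmodP; apply: gen_ordered_iso.
by apply/eqmodP; rewrite reprK.
Qed.
Canonical pi_gen_op_morph n (a : generator) (i : 'I_n) :=
  PiMorph1 (@pi_gen_op n a i).

Definition word_op n (w : seq generator) (i : 'I_n) (G : oegraph n) : oegraph n :=
  foldr (fun a => gen_op a i) G w.

(* The set of all embedded graphs with linearly ordered edges having an edge at
   position i *)
Record oegraph_at (i : nat) := OEGraphAt {
  nb_edges : nat;
  edge_at : i < nb_edges;
  ograph : oegraph nb_edges }.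

Definition gen_op_at (i : nat) (a : generator) (G : oegraph_at i) : oegraph_at i :=
  OEGraphAt (edge_at G) (gen_op a (Ordinal (edge_at G)) (ograph G)).

(* The actions of mathcomp.fingroup.action are right actions, whereas here
   (xi zeta, i) means: first (zeta, i), then (xi, i). *)
Definition left_action (gT : groupType) (X : Type) (act : gT -> X -> X) : Prop :=
  (forall x, act 1 x = x) /\ (forall g h x, act (g * h) x = act g (act h x)).

Definition relators (gT : groupType) (d t : gT) : Prop :=
  [/\ d ^+ 2 = 1, t ^+ 2 = 1 & (t * d) ^+ 3 = 1].

(* gT is the group < d, t | d^2, t^2, (t d)^3 >, by its universal property
   among all groups, finite or not. *)
Definition presented_by (gT : groupType) (d t : gT) : Prop :=
  [/\ relators d t,
      forall (rT : groupType) (d' t' : rT), relators d' t' ->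
        exists f : gT -> rT, [/\ monoid_morphism f, f d = d' & f t = t']
    & forall (rT : groupType) (f f' : gT -> rT),
        monoid_morphism f -> monoid_morphism f' ->
        f d = f' d -> f t = f' t -> f =1 f'].

(* Main.v *)
Require Import Defs.
From mathcomp Require Import all_boot all_fingroup all_solvable.

(** Both operations at an edge e replace the two arrows labelled e by new ones
    drawn between the same four ends: they act on an arrow presentation through
    a permutation of its ends, and composing operations multiplies these
    permutations ([replace_arrowsM]).  The half-twist is a transposition and its
    product with the dual is a 3-cycle ([half_twist_dual_order3]), which
    gives tau^2 = (tau delta)^3 = 1 already for presentations.  The square of
    the dual exchanges the two arrows labelled e; the result is an
    isomorphic presentation, in general not the same one, so that delta^2 = 1
    holds only once presentations are taken up to isomorphism.

    For the action, let maps D and T on a set X satisfy D^2 = T^2 = (TD)^3 = 1.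
    These relations give DTD = TDT, hence multiplying on the left by D or T
    permutes the six words 1, D, T, DT, TD, TDT in the way recorded by
    [left_mul_index] ([foldr_left_mul_index]).  The same words, read in the
    adjacent transpositions of S_3, list S_3 without repetition.  Letting g in
    S_3 act on X by the word that represents g thus defines an action
    ([S3_actM]).

    This one construction serves twice.  With X the set of ordered embedded
    graphs it is the required action.  With X any group R containing elements
    d and t that satisfy the relations, and D and T the left multiplications
    by d and t, the map g |-> g . 1 is the morphism from S_3 to R demanded by
    the universal property of the presentation: left multiplications commute
    with right ones, so the action of g is left multiplication by g . 1.  The
    morphism is unique because S_3 is generated by the two transpositions
    ([S3_gen_ind]). *)

Set Implicit Arguments.
Unset Strict Implicit.
Unset Printing Implicit Defensive.

Local Open Scope group_scope.
Local Open Scope quotient_scope.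

(** * Relations between the operations at an edge *)

Lemma replace_arrowsM n (p q : {perm arrow_end n}) (g : arrow_pres n) :
  replace_arrows p (replace_arrows q g) = replace_arrows (p * q) g.
Proof.
rewrite /replace_arrows /=; set P := is_pairingJ _ _; set Q := is_pairingJ _ _.
move: P Q; rewrite invMg conjgM => P Q; congr ArrowPres.
exact: bool_irrelevance.
Qed.

(** A replacement of arrows that permutes the two arrows of a label, or reverses
    both of them, only renames the ends of the arrows. *)
Lemma replace_arrows_rename n (p : {perm arrow_end n}) s r
    (G : ordered_pres n) :
  p =1 rename 1 s r -> pres_iso (replace_arrows p G.1, G.2) G.
Proof.
move=> pE; apply/pres_isoP; split=> //.
exists 1, s, r; apply/andP; split; apply/forallP=> x /=; last by rewrite perm1.
by rewrite -!pE !conjgE invgK !permM permKV.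
Qed.

(** Dualizing twice at e exchanges the two arrows labelled e, so that the result
    is the original presentation only up to isomorphism. *)
Lemma partial_dualK n (e : 'I_n) (G : ordered_pres n) :
  pres_iso (partial_dual e (partial_dual e G.1), G.2) G.
Proof.
rewrite /partial_dual replace_arrowsM.
apply: (@replace_arrows_rename _ _ [ffun x => x == e] [ffun=> false]).
move=> [[x a] h]; rewrite permM !permE /= !ffunE perm1 addbF.
by case: (x =P e) => [->|/eqP/negPf ne]; case: h; rewrite /= ?eqxx ?ne ?addbT ?addbF.
Qed.

Lemma half_twistK n (e : 'I_n) (G : ordered_pres n) :
  pres_iso (half_twist e (half_twist e G.1), G.2) G.
Proof.
rewrite /half_twist replace_arrowsM tperm2.
apply: (@replace_arrows_rename _ _ [ffun=> false] [ffun=> false]).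
by move=> [[x a] h]; rewrite !perm1 /= !ffunE perm1 !addbF.
Qed.

(** On the four ends of the arrows labelled e this product fixes the head of
    (e, false) and permutes the other three cyclically. *)
Lemma half_twist_dual_order3 n (e : 'I_n) :
  (tperm (e, false, false) (e, false, true) * perm (@dual_place_inj n e)) ^+ 3
    = 1.
Proof.
set q := _ * _.
have qE x a h : q (x, a, h) =
    if x == e then (if a == h then (e, ~~ a, false) else (e, a, true))
    else (x, a, h).
  rewrite permM permE; case: (x =P e) => [->|/eqP/negPf ne].
    by rewrite permE /= !xpair_eqE eqxx; case: a; case: h; rewrite /= eqxx.
  by rewrite tpermD /= ?ne // !xpair_eqE eq_sym ne.
(* Keeping q abstract prevents permM from unfolding it again. *)
move: q qE => q qE; apply/permP=> [[[x a] h]].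
rewrite !expgS expg0 mulg1 !permM perm1 qE.
case: (x =P e) => [->|/eqP/negPf ne]; last by rewrite /= qE ne qE ne.
by case: a; case: h; rewrite /= qE eqxx /= qE eqxx.
Qed.

Lemma half_twist_partial_dual3 n (e : 'I_n) (G : ordered_pres n) :
  pres_iso (half_twist e (partial_dual e (half_twist e (partial_dual e
             (half_twist e (partial_dual e G.1))))), G.2) G.
Proof.
have := half_twist_dual_order3 e; rewrite !expgS expg0 mulg1 !mulgA => td3.
rewrite /half_twist /partial_dual !replace_arrowsM td3.
apply: (@replace_arrows_rename _ _ [ffun=> false] [ffun=> false]).
by move=> [[x a] h]; rewrite perm1 /= !ffunE perm1 !addbF.
Qed.

Lemma pi_word_op n (w : seq Defs.generator) (i : 'I_n) (G : ordered_pres n) :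
  word_op w i (\pi_(oegraph n) G)
    = \pi_(oegraph n) (foldr (fun a => gen_ordered a i) G w).
Proof. by elim: w => //= a w ->; rewrite pi_gen_op. Qed.

Lemma word_op_id n (w : seq Defs.generator) (i : 'I_n) :
    (forall G, pres_iso (foldr (fun a => gen_ordered a i) G w) G) ->
  forall G : oegraph n, word_op w i G = G.
Proof.
by move=> wG G; elim/quotW: G => G; rewrite pi_word_op; apply/eqmodP/wG.
Qed.

Lemma gen_op_involutive n (a : Defs.generator) (i : 'I_n) : involutive (gen_op a i).
Proof.
case: a; apply: (@word_op_id _ [:: _; _]) => G.
  exact: partial_dualK.
exact: half_twistK.
Qed.

Lemma gen_op_order3 n (i : 'I_n) (G : oegraph n) :
  word_op [:: Tau; Delta; Tau; Delta; Tau; Delta] i G = G.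
Proof. by apply: word_op_id => {}G; apply: half_twist_partial_dual3. Qed.

(** * Maps satisfying the relations of S_3 *)

Definition S3_relations X (F : Defs.generator -> X -> X) : Prop :=
  (forall a, involutive (F a))
  /\ forall x, foldr F x [:: Tau; Delta; Tau; Delta; Tau; Delta] = x.

Lemma S3_relations_mulg (gT : groupType) (u : Defs.generator -> gT) :
  relators (u Delta) (u Tau) -> S3_relations (fun a x => u a * x).
Proof.
case=> d2 t2 td3; split=> [a x|x] /=; rewrite !mulgA.
  by case: a; rewrite -[u _ * u _]/(u _ ^+ 2) ?d2 ?t2 mul1g.
by move: td3; rewrite !expgS expg0 mulg1 !mulgA => ->; rewrite mul1g.
Qed.

Lemma S3_relations_gen_op_at i : S3_relations (@gen_op_at i).
Proof.
split=> [a|] [n ltin G]; rewrite /= /gen_op_at /=; congr OEGraphAt.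
  exact: gen_op_involutive.
exact: gen_op_order3.
Qed.

Definition normal_words : seq (seq Defs.generator) :=
  [:: [::]; [:: Delta]; [:: Tau]; [:: Delta; Tau]; [:: Tau; Delta];
      [:: Tau; Delta; Tau]].

(** The Cayley graph of S_3 on the positions in [normal_words]: the position of
    the word equivalent to the generator a followed by the k-th word. *)
Definition left_mul_index (a : Defs.generator) : nat -> nat :=
  nth 0 (if a is Delta then [:: 1; 0; 3; 2; 5; 4]
                       else [:: 2; 4; 0; 5; 1; 3])%N.

Lemma left_mul_index_lt a k :
  k < size normal_words -> left_mul_index a k < size normal_words.
Proof. by case: a; case: k => [|[|[|[|[|[|?]]]]]]. Qed.

(** Only the products of Delta with the last two words use the braid relation;
    all other cases are instances of the involutivity of F. *)
Lemma foldr_left_mul_index X (F : Defs.generator -> X -> X) a k x :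
    S3_relations F -> k < size normal_words ->
  foldr F x (nth [::] normal_words (left_mul_index a k))
    = F a (foldr F x (nth [::] normal_words k)).
Proof.
move=> [FK F3].
have braid y : F Delta (F Tau (F Delta y)) = F Tau (F Delta (F Tau y)).
  by rewrite -{2}[y]F3 /= !FK.
by case: a; case: k => [|[|[|[|[|[|k]]]]]] //= _; rewrite ?FK ?braid ?FK.
Qed.

(** * Normal forms in S_3 *)

Definition S3_gen (a : Defs.generator) : 'S_3 :=
  if a is Delta then tperm (inord 0) (inord 1) else tperm (inord 1) (inord 2).

Lemma S3_gen_relators : relators (S3_gen Delta) (S3_gen Tau).
Proof.
split; try exact: tperm2.
apply/permP=> x; rewrite !expgS expg0 mulg1 !permM perm1.
apply: val_inj.
case: x => [[|[|[|]]] //= ltx];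
  by do ?rewrite permE /= -?val_eqE /= ?inordK //=.
Qed.

Definition S3_elements : seq 'S_3 :=
  [seq foldr (fun a g => S3_gen a * g) 1 w | w <- normal_words].

Lemma S3_elements_uniq : uniq S3_elements.
Proof.
(* A permutation of three points is known from the images of two of them. *)
pose v (p : 'S_3) := (p (inord 0) : nat, p (inord 1) : nat).
apply: (@map_uniq _ _ v).
rewrite /= /v !mulg1 !permM !perm1.
by do ?rewrite /= ?permE /= -?val_eqE /= ?inordK //=.
Qed.

Lemma mem_S3_elements (g : 'S_3) : g \in S3_elements.
Proof.
have sub : {subset S3_elements <= enum 'S_3} by move=> x _; rewrite mem_enum.
have le : size (enum 'S_3) <= size S3_elements by rewrite -cardT card_Sn.
by rewrite (uniq_min_size S3_elements_uniq sub le).2 mem_enum.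
Qed.

Lemma S3_gen_ind (P : 'S_3 -> Prop) :
  P 1 -> (forall a g, P g -> P (S3_gen a * g)) -> forall g, P g.
Proof.
move=> P1 PM g; have [k ltk <-] := nthP 1 (mem_S3_elements g).
by rewrite (nth_map [::]) //; elim: (nth _ _ _) => //= a w; apply: PM.
Qed.

(** * The action of S_3 *)

Definition S3_act X (F : Defs.generator -> X -> X) (g : 'S_3) (x : X) : X :=
  foldr F x (nth [::] normal_words (index g S3_elements)).

Section S3Action.

Variables (X : Type) (F : Defs.generator -> X -> X).
Hypothesis relF : S3_relations F.

Lemma S3_act1 x : S3_act F 1 x = x.
Proof. by rewrite /S3_act /= eqxx. Qed.

(** The maps F and the left multiplications of S_3 permute the words in the same
    way, which locates the word of S3_gen a * g from the word of g. *)
Lemma S3_act_genM a g x : S3_act F (S3_gen a * g) x = F a (S3_act F g x).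
Proof.
have := mem_S3_elements g; rewrite -index_mem /S3_act => ltk.
have ltk' : index g S3_elements < size normal_words by [].
rewrite -foldr_left_mul_index //; congr (foldr F x (nth _ _ _)).
have lt_ak := left_mul_index_lt a ltk'.
rewrite -(@index_uniq _ 1 (left_mul_index a _) S3_elements) ?S3_elements_uniq //.
congr index; rewrite (nth_map [::]) //.
rewrite (foldr_left_mul_index _ _ (S3_relations_mulg S3_gen_relators)) //.
by congr (_ * _); rewrite -{1}(nth_index 1 (mem_S3_elements g)) (nth_map [::]).
Qed.

Lemma S3_act_gen a x : S3_act F (S3_gen a) x = F a x.
Proof. by rewrite -[S3_gen a]mulg1 S3_act_genM S3_act1. Qed.

Lemma S3_actM g h x : S3_act F (g * h) x = S3_act F g (S3_act F h x).
Proof.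
elim/S3_gen_ind: g => [|a g IHg]; first by rewrite mul1g S3_act1.
by rewrite -mulgA !S3_act_genM IHg.
Qed.

Lemma S3_left_action : left_action (S3_act F).
Proof. by split; [apply: S3_act1 | apply: S3_actM]. Qed.

End S3Action.

(** * The presentation of S_3 *)

Section S3Morphism.

Variables (gT : groupType) (u : Defs.generator -> gT).
Hypothesis relu : relators (u Delta) (u Tau).

Definition S3_hom (g : 'S_3) : gT := S3_act (fun a x => u a * x) g 1.

Let rel_mul := S3_relations_mulg relu.

Lemma S3_hom_gen a : S3_hom (S3_gen a) = u a.
Proof. by rewrite /S3_hom S3_act_gen // mulg1. Qed.

Lemma S3_hom_monoid_morphism : monoid_morphism S3_hom.
Proof.
split=> [|g h]; first exact: S3_act1.
rewrite /S3_hom S3_actM //; move: (S3_act _ h 1) => y.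
elim/S3_gen_ind: g => [|a g IHg]; first by rewrite !S3_act1 mul1g.
by rewrite !S3_act_genM // IHg mulgA.
Qed.

End S3Morphism.

Lemma S3_presented_by : presented_by (S3_gen Delta) (S3_gen Tau).
Proof.
split=> [|rT d t reldt|rT f f' [f1 fM] [f'1 f'M] fd ft].
- exact: S3_gen_relators.
- pose u a := if a is Delta then d else t.
  exists (S3_hom u); split; last 2 first.
  + exact: (@S3_hom_gen _ u reldt Delta).
  + exact: (@S3_hom_gen _ u reldt Tau).
  exact: S3_hom_monoid_morphism.
elim/S3_gen_ind=> [|a g IHg]; first by rewrite f1 f'1.
by rewrite fM f'M IHg; case: a; rewrite ?fd ?ft.
Qed.

(** Here the isomorphism is with the presentation among finite groups: S_3
    satisfies the relations, and every finite group generated by two elements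
    that satisfy them is an image of S_3. *)
Lemma S3_isog_Grp :
  [set: 'S_3] \isog Grp (d : t : d ^+ 2, t ^+ 2, (t * d) ^+ 3).
Proof.
apply: (intro_isoGrp (G := [set: 'S_3]%G)) => [|rT H].
  have [d2 t2 td3] := S3_gen_relators.
  apply/existsP; exists (S3_gen Delta, S3_gen Tau).
  rewrite /= !xpair_eqE d2 t2 td3 !eqxx !andbT.
  rewrite eqEsubset subsetT; apply/subsetP=> g _.
  elim/S3_gen_ind: g => [|a g IHg]; first exact: group1.
  rewrite groupM //; case: a.
    by rewrite mem_gen // inE cycle_id.
  by rewrite mem_gen // inE cycle_id orbT.
case/existsP=> -[d t] /eqP[defH d2 t2 td3].
pose u a := if a is Delta then d else t.
have relu : relators (u Delta) (u Tau) by [].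
have [h1 hM] := S3_hom_monoid_morphism relu.
pose h := @Morphism _ _ [set: 'S_3] (S3_hom u) (in2W hM).
apply/homgP; exists h; rewrite -defH.
apply/eqP; rewrite eqEsubset join_subG !cycle_subG; apply/and3P; split.
- apply/subsetP=> _ /morphimP[g _ _ ->] /=.
  elim/S3_gen_ind: g => [|a g IHg]; first by rewrite h1 group1.
  rewrite hM groupM // S3_hom_gen //; case: a.
    by rewrite mem_gen // inE cycle_id.
  by rewrite mem_gen // inE cycle_id orbT.
- by rewrite -[d](S3_hom_gen relu Delta) (mem_morphim h) ?inE.
- by rewrite -[t](S3_hom_gen relu Tau) (mem_morphim h) ?inE.
Qed.

Theorem lemma3p3 :
  (forall (n : nat) (G : oegraph n) (i : 'I_n),
     [/\ word_op [:: Tau; Tau] i G = word_op [:: Delta; Delta] i G,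
         word_op [:: Delta; Delta] i G
           = word_op [:: Tau; Delta; Tau; Delta; Tau; Delta] i G,
         word_op [:: Tau; Delta; Tau; Delta; Tau; Delta] i G
           = word_op [::] i G
       & word_op [::] i G = G])
  /\ ([set: 'S_3] \isog Grp (d : t : d ^+ 2, t ^+ 2, (t * d) ^+ 3))
  /\ (exists d t : 'S_3,
        presented_by d t
        /\ forall i : nat,
             exists act : 'S_3 -> oegraph_at i -> oegraph_at i,
               [/\ left_action act,
                   forall G, act d G = gen_op_at Delta G
                 & forall G, act t G = gen_op_at Tau G]).
Proof.
split=> [n G i|]; last first.
  split; first exact: S3_isog_Grp.
  exists (S3_gen Delta), (S3_gen Tau); split; first exact: S3_presented_by.
  move=> i; have rel_i := S3_relations_gen_op_at i.
  exists (S3_act (@gen_op_at i)); split; first exact: S3_left_action.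
  + exact: (S3_act_gen rel_i Delta).
  + exact: (S3_act_gen rel_i Tau).
have KE a : word_op [:: a; a] i G = G by apply: gen_op_involutive.
by rewrite !KE gen_op_order3.
Qed.
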